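(* Let $\{A,B,C\}\subset S^{1,1}$ be a non-contractible spatiolateral de Sitter triangle with side lengths $a,b,c$ opposite $A,B,C$ and angles $\alpha,\beta,\gamma$ at $A,B,C$, respectively. Then $$\cos(a)=\cos(b)\cos(c)-\cosh(\alpha)\sin(b)\sin(c),$$ $$\cos(b)=\cos(a)\cos(c)-\cosh(\beta)\sin(a)\sin(c),$$ $$\cos(c)=\cos(a)\cos(b)-\cosh(\gamma)\sin(a)\sin(b).$$
   Context: On $\mathbb{R}^3$ let $\langle\langle x,y\rangle\rangle=-x_1y_1+x_2y_2+x_3y_3$, $|||x|||=\sqrt{|\langle\langle x,x\rangle\rangle|}$, and let $\times$ be the Euclidean cross product. $S^{1,1}=\{x:\langle\langle x,x\rangle\rangle=1\}$. A two-dimensional linear subspace is spacelike if $\langle\langle\cdot,\cdot\rangle\rangle$ restricted to it is positive definite. For $A,B\in S^{1,1}$ with $A\ne\pm B$, the side between $A$ and $B$ is spacelike if $\operatorname{span}(A,B)$ is spacelike (equivalently $|\langle\langle A,B\rangle\rangle|<1$); its length is then $\arccos(\langle\langle A,B\rangle\rangle)\in(0,\pi)$, and the unit tangent vector at $A$ towards $B$ is $X_{AB}=\dfrac{B-\langle\langle A,B\rangle\rangle A}{|||A\times B|||}$. A spatiolateral triangle is a set of three distinct points $\{A,B,C\}\subset S^{1,1}$ all of whose sides are spacelike. It is contractible if, after projecting the vertices to the $(x_2,x_3)$-plane, there is a line through the origin such that all three projected points lie on one side of the line; otherwise it is non-contractible. Side lengths: $a$ between $B$ and $C$, $b$ between $A$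 and $C$, $c$ between $A$ and $B$. The angle at $A$ is $\alpha=\operatorname{arcosh}(|\langle\langle X_{AB},X_{AC}\rangle\rangle|)\ge 0$, and analogously $\beta$ at $B$, $\gamma$ at $C$. *)

(* Defs.v *)
From HB Require Import structures.
From mathcomp Require Import all_boot all_order all_algebra.
From mathcomp Require Import all_classical all_reals all_analysis.

Set Implicit Arguments.
Unset Strict Implicit.
Unset Printing Implicit Defensive.

Import Order.TTheory GRing.Theory Num.Theory.
Import numFieldNormedType.Exports.

Local Open Scope classical_set_scope.
Local Open Scope ring_scope.

Section Hyperbolic.
Variable R : realType.

Definition cosh (x : R) : R := (expR x + expR (- x)) / 2.

(* Inverse of cosh : [0, +oo[ -> [1, +oo[, with the junk value 0 on
   arguments smaller than 1; compare acos. *)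
Definition arcosh (x : R) : R := xget 0 [set t | 0 <= t /\ cosh t = x].

End Hyperbolic.

(* The coordinates x_1, x_2, x_3 are x 0 0, x 0 1, x 0 2; column indices live
   in the ring 'I_3 of integers modulo 3. *)
Section DeSitter.
Variable R : realType.
Implicit Types (x y A B C : 'rV[R]_3).

Definition mdot x y : R :=
  - (x 0 0 * y 0 0) + x 0 1 * y 0 1 + x 0 2 * y 0 2.

Definition mnorm x : R := Num.sqrt `|mdot x x|.

(* Euclidean cross product: k + 1 and k + 2 are taken modulo 3. *)
Definition cross x y : 'rV[R]_3 :=
  \row_(k < 3) (x 0 (k + 1) * y 0 (k + 2) - x 0 (k + 2) * y 0 (k + 1)).

Definition deSitter : set 'rV[R]_3 := [set x | mdot x x = 1].

Definition spacelike (U : {vspace 'rV[R]_3}) : Prop :=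
  \dim U = 2%N /\ forall x, x \in U -> x != 0 -> 0 < mdot x x.

Definition spacelike_side A B : Prop :=
  [/\ A != B, A != - B & spacelike (<[A]> + <[B]>)%VS].

Definition side_length A B : R := acos (mdot A B).

Definition unit_tangent A B : 'rV[R]_3 :=
  (mnorm (cross A B))^-1 *: (B - mdot A B *: A).

(* The angle at A of the triangle with vertices A, B, C. *)
Definition angle A B C : R :=
  arcosh `|mdot (unit_tangent A B) (unit_tangent A C)|.

Definition spatiolateral A B C : Prop :=
  [/\ deSitter A, deSitter B & deSitter C] /\
  uniq [:: A; B; C] /\
  [/\ spacelike_side A B, spacelike_side A C & spacelike_side B C].

(* Projection to the (x_2, x_3)-plane. *)
Definition proj23 x : 'rV[R]_2 := col' 0 x.

(* The line is the one through the origin with normal vector n, and "one side"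
   is the open half-plane towards which n points. For spatiolateral triangles
   closed half-planes give the same notion: two vertices joined by a spacelike
   side never project to opposite rays. *)
Definition contractible A B C : Prop :=
  exists2 n : 'rV[R]_2, n != 0 &
    forall P, P \in [:: A; B; C] -> 0 < \sum_(j < 2) n 0 j * proj23 P 0 j.

End DeSitter.

(* Main.v *)
(** If the projected vertices lie in no open half-plane, then by Gordan's
    alternative some nonzero combination [v = x A + y B + z C] with
    [x, y, z >= 0] projects to [0], so [<v, v> <= 0].  Splitting off the component
    of [v] along [A] leaves
    [y^2 (1 - <A,B>^2) + z^2 (1 - <A,C>^2) + 2 y z (<B,C> - <A,B> <A,C>) <= 0],
    which forces [<B,C> < <A,B> <A,C>].  Hence [<X_AB, X_AC>] is negative; the Gram
    determinant of [A, B, C] is minus a square, so [|<X_AB, X_AC>| >= 1] and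
    [cosh alpha = - <X_AB, X_AC>]. *)
Require Import Defs.
From HB Require Import structures.
From mathcomp Require Import all_boot all_order all_algebra.
From mathcomp Require Import all_classical all_reals all_analysis.
From mathcomp Require Import ring lra.

Set Implicit Arguments.
Unset Strict Implicit.
Unset Printing Implicit Defensive.

Import Order.TTheory GRing.Theory Num.Theory.
Import numFieldNormedType.Exports.
Local Open Scope ring_scope.

(** * Gordan's alternative for three vectors of the plane *)

Section Gordan.
Variable R : realFieldType.

Definition open_half_plane (u1 u2 v1 v2 w1 w2 : R) : Prop :=
  exists n1 n2 : R,
    [/\ 0 < n1 * u1 + n2 * u2, 0 < n1 * v1 + n2 * v2 & 0 < n1 * w1 + n2 * w2].

Definition positively_dependent (u1 u2 v1 v2 w1 w2 : R) : Prop :=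
  exists x y z : R, [/\ [/\ 0 <= x, 0 <= y & 0 <= z], 0 < x + y + z,
    x * u1 + y * v1 + z * w1 = 0 & x * u2 + y * v2 + z * w2 = 0].

(** When [u] and [v] form a basis, a linear form may take any values on them, and Cramer's relation
    [d1 u + d2 v + d3 w = 0] fixes its value on [w]. The signs of [d1 * d3] and [d2 * d3] decide
    which alternative occurs. *)
Lemma gordan_plane_basis (u1 u2 v1 v2 w1 w2 : R) :
  u1 * v2 - u2 * v1 != 0 ->
  open_half_plane u1 u2 v1 v2 w1 w2 \/ positively_dependent u1 u2 v1 v2 w1 w2.
Proof.
set d3 := u1 * v2 - u2 * v1 => d3_neq0.
have d3_gt0 : 0 < d3 * d3 by rewrite -expr2 exprn_even_gt0.
pose d1 := v1 * w2 - v2 * w1; pose d2 := w1 * u2 - w2 * u1.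
(* [n] takes the values [s d3^2] on [u], [t d3^2] on [v] and
   [- (s d1 d3 + t d2 d3)] on [w], because [d1 u + d2 v + d3 w = 0]. *)
have half s t : 0 < s -> 0 < t -> s * (d1 * d3) + t * (d2 * d3) < 0 ->
    open_half_plane u1 u2 v1 v2 w1 w2.
  move=> s_gt0 t_gt0 st_lt0.
  exists (d3 * (s * v2 - t * u2)), (d3 * (t * u1 - s * v1)); split.
  - have -> : d3 * (s * v2 - t * u2) * u1 + d3 * (t * u1 - s * v1) * u2
      = s * (d3 * d3) by rewrite /d3; ring.
    exact: mulr_gt0.
  - have -> : d3 * (s * v2 - t * u2) * v1 + d3 * (t * u1 - s * v1) * v2
      = t * (d3 * d3) by rewrite /d3; ring.
    exact: mulr_gt0.
  - have -> : d3 * (s * v2 - t * u2) * w1 + d3 * (t * u1 - s * v1) * w2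
      = - (s * (d1 * d3) + t * (d2 * d3)) by rewrite /d1 /d2; ring.
    by rewrite oppr_gt0.
case: (ltP (d1 * d3) 0) => [d13|d13].
  (* These [s] and [t] factor the sum as the negative [d1 * d3] times a number that is at least
     1. *)
  left; apply: (half (1 + `|d2 * d3|) (- (d1 * d3))).
  - by rewrite ltr_wpDr.
  - by rewrite oppr_gt0.
  have -> : (1 + `|d2 * d3|) * (d1 * d3) + - (d1 * d3) * (d2 * d3)
    = (d1 * d3) * (1 + `|d2 * d3| - d2 * d3) by ring.
  by rewrite nmulr_rlt0 //; have := ler_norm (d2 * d3); lra.
case: (ltP (d2 * d3) 0) => [d23|d23].
  left; apply: (half (- (d2 * d3)) (1 + `|d1 * d3|)).
  - by rewrite oppr_gt0.
  - by rewrite ltr_wpDr.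
  have -> : - (d2 * d3) * (d1 * d3) + (1 + `|d1 * d3|) * (d2 * d3)
    = (d2 * d3) * (1 + `|d1 * d3| - d1 * d3) by ring.
  by rewrite nmulr_rlt0 //; have := ler_norm (d1 * d3); lra.
(* Cramer's relation multiplied by [d3], so that the last weight is a positive square. *)
right; exists (d1 * d3), (d2 * d3), (d3 * d3); split.
- by split=> //; exact: ltW.
- lra.
- by rewrite /d1 /d2 /d3; ring.
- by rewrite /d1 /d2 /d3; ring.
Qed.

Lemma gordan_plane (u1 u2 v1 v2 w1 w2 : R) :
  open_half_plane u1 u2 v1 v2 w1 w2 \/ positively_dependent u1 u2 v1 v2 w1 w2.
Proof.
have [uv0|] := eqVneq (u1 * v2 - u2 * v1) 0; last exact: gordan_plane_basis.
have [vw0|vw] := eqVneq (v1 * w2 - v2 * w1) 0; last first.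
  have [[n1 [n2 [nv nw nu]]]|[y [z [x [[y0 z0 x0] xyz e1 e2]]]]] :=
    gordan_plane_basis u1 u2 vw.
    by left; exists n1, n2.
  by right; exists x, y, z; split=> //; lra.
have [uw0|uw] := eqVneq (u1 * w2 - u2 * w1) 0; last first.
  have [[n1 [n2 [nu nw nv]]]|[x [z [y [[x0 z0 y0] xyz e1 e2]]]]] :=
    gordan_plane_basis v1 v2 uw.
    by left; exists n1, n2.
  by right; exists x, y, z; split=> //; lra.
(* Now the vectors are pairwise parallel. For [u] nonzero, the normal [n = u] works unless [v] or
   [w] is zero or opposite to [u]; if [v] is, [- (u . v) u + (u . u) v = 0] is a dependence, and
   likewise for [w]. *)
have [uu_le0|uu_gt0] := leP (u1 * u1 + u2 * u2) 0.
  have u1_0 : u1 = 0.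
    by apply/eqP; rewrite -sqrf_eq0 eq_le sqr_ge0 andbT; have := sqr_ge0 u2; lra.
  have u2_0 : u2 = 0.
    by apply/eqP; rewrite -sqrf_eq0 eq_le sqr_ge0 andbT; have := sqr_ge0 u1; lra.
  by right; exists 1, 0, 0; rewrite u1_0 u2_0; split; [split| | |]; lra.
have [uv_le0|uv_gt0] := leP (u1 * v1 + u2 * v2) 0.
  right; exists (- (u1 * v1 + u2 * v2)), (u1 * u1 + u2 * u2), 0.
  split; [by split; lra | lra | |].
    transitivity (- u2 * (u1 * v2 - u2 * v1)); first by ring.
    by rewrite uv0 mulr0.
  transitivity (u1 * (u1 * v2 - u2 * v1)); first by ring.
  by rewrite uv0 mulr0.
have [uw_le0|uw_gt0] := leP (u1 * w1 + u2 * w2) 0.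
  right; exists (- (u1 * w1 + u2 * w2)), 0, (u1 * u1 + u2 * u2).
  split; [by split; lra | lra | |].
    transitivity (- u2 * (u1 * w2 - u2 * w1)); first by ring.
    by rewrite uw0 mulr0.
  transitivity (u1 * (u1 * w2 - u2 * w1)); first by ring.
  by rewrite uw0 mulr0.
by left; exists u1, u2.
Qed.

End Gordan.

(** * The inverse hyperbolic cosine *)

Section HyperbolicCosine.
Variable R : realType.

(** [xget] returns a member of any nonempty set, so a single solution suffices: [ln (y + s)] with
    [s ^+ 2 = y ^+ 2 - 1], where [y + s] and [y - s] are mutually inverse. *)
Lemma arcoshK (y : R) : 1 <= y -> cosh (arcosh y) = y.
Proof.
move=> y_ge1.
suff : exists t : R, 0 <= t /\ cosh t = y.
  by move=> /cid[t yt]; rewrite /arcosh; case: xgetP => [s _ []//|/(_ t)].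
have y2 : 0 <= y ^+ 2 - 1 by rewrite subr_ge0 exprn_ege1.
have ss := sqr_sqrtr y2; have s_ge0 := sqrtr_ge0 (y ^+ 2 - 1).
move: (Num.sqrt _) ss s_ge0 => s ss s_ge0.
have ys_gt0 : 0 < y + s by lra.
exists (ln (y + s)); split; first by apply: ln_ge0; lra.
rewrite /cosh expRN lnK ?posrE //.
have -> : (y + s)^-1 = y - s.
  apply: (mulfI (lt0r_neq0 ys_gt0)); rewrite divff ?lt0r_neq0 //.
  by rewrite mulrC -subr_sqr ss; ring.
by field.
Qed.

End HyperbolicCosine.

(** * Lorentzian geometry of the vertices, and the cosine law at one vertex *)

Section DeSitterGeometry.
Variable R : realType.
Implicit Types A B C : 'rV[R]_3.

Lemma mdotC A B : mdot A B = mdot B A.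
Proof. by rewrite /mdot; ring. Qed.

(** Lorentzian form of Lagrange's identity. The Lorentzian cross product differs from the Euclidean
    one by the sign of the first coordinate, which [mdot] of a vector with itself does not see. *)
Lemma mdot_cross A B :
  mdot (cross A B) (cross A B) = mdot A B ^+ 2 - mdot A A * mdot B B.
Proof.
have e12 : 1 + 2 = 0 :> 'I_3 by apply/val_inj.
have e21 : 2 + 1 = 0 :> 'I_3 by apply/val_inj.
have e22 : 2 + 2 = 1 :> 'I_3 by apply/val_inj.
have e11 : 1 + 1 = 2 :> 'I_3 by apply/val_inj.
by rewrite /mdot !mxE !add0r e12 e21 e22 e11; ring.
Qed.

(** With [M] the matrix of rows [A], [B], [C] and [J = diag(-1, 1, 1)], the left side is
    [det (M J M^T) = - (det M)^2]. *)
Lemma gram_det_le0 A B C :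
  mdot A A * mdot B B * mdot C C + 2 * mdot A B * mdot A C * mdot B C
  - mdot A A * mdot B C ^+ 2 - mdot B B * mdot A C ^+ 2
  - mdot C C * mdot A B ^+ 2 <= 0.
Proof.
rewrite [leLHS](_ : _ = - (A 0 0 * (B 0 1 * C 0 2 - B 0 2 * C 0 1)
  - A 0 1 * (B 0 0 * C 0 2 - B 0 2 * C 0 0)
  + A 0 2 * (B 0 0 * C 0 1 - B 0 1 * C 0 0)) ^+ 2).
  by rewrite oppr_le0 sqr_ge0.
by rewrite /mdot; ring.
Qed.

(** [1 - p ^+ 2] is the square norm of [B - p *: A], a vector of the spacelike plane; it is nonzero,
    as otherwise [p ^+ 2 = 1] and [B] would be [A] or [- A]. *)
Lemma spacelike_side_mdot A B :
  deSitter A -> deSitter B -> spacelike_side A B -> 0 < 1 - mdot A B ^+ 2.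
Proof.
move=> AA BB [AB ANB [_ pos]].
set p := mdot A B.
have ortho : mdot (B - p *: A) (B - p *: A) = 1 - p ^+ 2.
  transitivity (mdot B B - 2 * p * mdot A B + p ^+ 2 * mdot A A).
    by rewrite /mdot !mxE; ring.
  by rewrite AA BB -/p; ring.
rewrite -ortho; apply: pos.
  rewrite rpredB ?rpredZ // memvE ?addvSr //; exact: addvSl.
apply/negP => B_eq0.
have p2 : p ^+ 2 = 1.
  by apply/eqP; rewrite eq_sym -subr_eq0 -ortho (eqP B_eq0) /mdot !mxE; apply/eqP; ring.
move: B_eq0; rewrite subr_eq0 => /eqP BpA.
move/eqP: p2; rewrite sqrf_eq1 => /orP[]/eqP p1; move: BpA; rewrite p1.
  by rewrite scale1r => BA; rewrite BA eqxx in AB.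
by rewrite scaleN1r => BA; rewrite BA opprK eqxx in ANB.
Qed.

Definition positively_spans_axis A B C : Prop :=
  positively_dependent (A 0 1) (A 0 2) (B 0 1) (B 0 2) (C 0 1) (C 0 2).

Lemma noncontractible_positively_spans_axis A B C :
  ~ contractible A B C -> positively_spans_axis A B C.
Proof.
move=> ncontr; case: (gordan_plane (A 0 1) (A 0 2) (B 0 1) (B 0 2) (C 0 1) (C 0 2)) => //.
move=> [n1 [n2 [nA nB nC]]]; case: ncontr.
have projE (P : 'rV[R]_3) :
    \sum_(j < 2) (\row_(j < 2) (if j == 0 then n1 else n2)) 0 j * proj23 P 0 j
    = n1 * P 0 1 + n2 * P 0 2.
  rewrite !big_ord_recl big_ord0 addr0 !mxE /=.
  by congr (_ * P _ _ + _ * P _ _); apply/val_inj.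
exists (\row_(j < 2) (if j == 0 then n1 else n2)); last first.
  by move=> P; rewrite projE !inE => /or3P[]/eqP->.
(* The normal is nonzero because its form is positive at [A]. *)
apply/negP => /eqP n0; move: nA; rewrite -projE n0 big1 ?ltxx // => j _.
by rewrite mxE mul0r.
Qed.

Lemma positively_spans_axisC12 A B C :
  positively_spans_axis A B C -> positively_spans_axis B A C.
Proof.
move=> [x [y [z [[x0 y0 z0] xyz e1 e2]]]].
by exists y, x, z; split=> //; lra.
Qed.

Lemma positively_spans_axis_rot A B C :
  positively_spans_axis A B C -> positively_spans_axis C A B.
Proof.
move=> [x [y [z [[x0 y0 z0] xyz e1 e2]]]].
by exists z, x, y; split=> //; lra.
Qed.

Lemma mdot_lt_of_spans_axis A B C :
  deSitter A -> deSitter B -> deSitter C ->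
  0 < 1 - mdot A B ^+ 2 -> 0 < 1 - mdot A C ^+ 2 ->
  positively_spans_axis A B C -> mdot B C < mdot A B * mdot A C.
Proof.
move=> AA BB CC p_gt0 q_gt0 [x [y [z [[x0 y0 z0] xyz e1 e2]]]].
rewrite ltNge; apply/negP => rpq; rewrite -subr_ge0 in rpq.
set p := mdot A B in p_gt0 rpq *; set q := mdot A C in q_gt0 rpq *.
set r := mdot B C in rpq *.
pose v0 := x * A 0 0 + y * B 0 0 + z * C 0 0.
(* Both sides are [mdot v v] for [v = x A + y B + z C]: the left completes the square along [A], the
   right uses that [v] lies on the first axis. *)
have key : y ^+ 2 * (1 - p ^+ 2) + z ^+ 2 * (1 - q ^+ 2)
    + 2 * (y * z * (r - p * q)) + (x + y * p + z * q) ^+ 2 = - v0 ^+ 2.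
  transitivity (- v0 ^+ 2 + (x * A 0 1 + y * B 0 1 + z * C 0 1) ^+ 2
    + (x * A 0 2 + y * B 0 2 + z * C 0 2) ^+ 2); last first.
    by rewrite e1 e2; ring.
  transitivity (x ^+ 2 * mdot A A + y ^+ 2 * mdot B B + z ^+ 2 * mdot C C
    + 2 * (x * y * p + x * z * q + y * z * r)).
    by rewrite AA BB CC; ring.
  by rewrite /v0 /p /q /r /mdot; ring.
have t1 : 0 <= y ^+ 2 * (1 - p ^+ 2) by rewrite mulr_ge0 ?sqr_ge0 // ltW.
have t2 : 0 <= z ^+ 2 * (1 - q ^+ 2) by rewrite mulr_ge0 ?sqr_ge0 // ltW.
have t3 : 0 <= y * z * (r - p * q) by rewrite !mulr_ge0.
have t4 := sqr_ge0 (x + y * p + z * q); have t5 := sqr_ge0 v0.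
(* A sum of nonnegative terms equals [- v0 ^+ 2], so each term vanishes; this kills [y], [z], then
   [x], against [0 < x + y + z]. *)
have y_0 : y = 0.
  have /eqP : y ^+ 2 * (1 - p ^+ 2) = 0 by lra.
  by rewrite mulf_eq0 (gt_eqF p_gt0) orbF sqrf_eq0 => /eqP.
have z_0 : z = 0.
  have /eqP : z ^+ 2 * (1 - q ^+ 2) = 0 by lra.
  by rewrite mulf_eq0 (gt_eqF q_gt0) orbF sqrf_eq0 => /eqP.
have /eqP : (x + y * p + z * q) ^+ 2 = 0 by lra.
by rewrite sqrf_eq0 y_0 z_0 !mul0r !addr0 => /eqP x_0; lra.
Qed.

Lemma mdot_unit_tangent A B C : deSitter A ->
  mdot (unit_tangent A B) (unit_tangent A C) =
  (mdot B C - mdot A B * mdot A C) / (mnorm (cross A B) * mnorm (cross A C)).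
Proof.
move=> AA; rewrite /unit_tangent invfM.
transitivity ((mdot B C - mdot A C * mdot A B - mdot A B * mdot A C
    + mdot A B * mdot A C * mdot A A) *
  ((mnorm (cross A B))^-1 * (mnorm (cross A C))^-1)).
  by rewrite {1 2 3 4 5 6 7 8 9}/mdot !mxE /mdot; ring.
by rewrite AA; ring.
Qed.

(** The normal of a spacelike plane is timelike, so the absolute value in [mnorm] reverses the sign
    given by [mdot_cross]. *)
Lemma mnorm_cross A B : deSitter A -> deSitter B -> 0 < 1 - mdot A B ^+ 2 ->
  mnorm (cross A B) = Num.sqrt (1 - mdot A B ^+ 2).
Proof.
by move=> AA BB AB; rewrite /mnorm mdot_cross AA BB mulr1 distrC gtr0_norm.
Qed.

Lemma mdot_itv A B : 0 < 1 - mdot A B ^+ 2 -> -1 <= mdot A B <= 1.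
Proof.
rewrite subr_gt0 => AB; rewrite -ler_norml -(ler_pXn2r (n := 2)) ?nnegrE //.
by rewrite expr1n real_normK ?num_real // ltW.
Qed.

(** The law at the vertex [A]; since the span condition is symmetric in the vertices, relabelling
    gives the laws at [B] and [C]. *)
Lemma noncontractible_cosine_law A B C :
  deSitter A -> deSitter B -> deSitter C ->
  spacelike_side A B -> spacelike_side A C -> spacelike_side B C ->
  positively_spans_axis A B C ->
  cos (side_length B C) = cos (side_length A C) * cos (side_length A B)
    - cosh (angle A B C) * sin (side_length A C) * sin (side_length A B).
Proof.
move=> AA BB CC sAB sAC sBC span.
have pAB := spacelike_side_mdot AA BB sAB.
have pAC := spacelike_side_mdot AA CC sAC.
have pBC := spacelike_side_mdot BB CC sBC.
have neg := mdot_lt_of_spans_axis AA BB CC pAB pAC span.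
have gram := gram_det_le0 A B C; rewrite AA BB CC in gram.
rewrite /side_length !acosK ?in_itv /= ?mdot_itv // !sin_acos ?mdot_itv //.
rewrite /angle mdot_unit_tangent // !mnorm_cross //.
set s := Num.sqrt (1 - mdot A B ^+ 2); set t := Num.sqrt (1 - mdot A C ^+ 2).
have s_gt0 : 0 < s by rewrite sqrtr_gt0.
have t_gt0 : 0 < t by rewrite sqrtr_gt0.
have ss : s ^+ 2 = 1 - mdot A B ^+ 2 by rewrite sqr_sqrtr // ltW.
have tt : t ^+ 2 = 1 - mdot A C ^+ 2 by rewrite sqr_sqrtr // ltW.
have st_gt0 : 0 < s * t by exact: mulr_gt0.
have norm_eq : `|(mdot B C - mdot A B * mdot A C) / (s * t)|
    = (mdot A B * mdot A C - mdot B C) / (s * t).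
  rewrite normrM normfV (gtr0_norm st_gt0) ltr0_norm ?subr_lt0 //.
  by rewrite opprB.
rewrite norm_eq arcoshK.
  by field; rewrite !gt_eqF.
(* After squaring, [1 <= cosh alpha] is exactly the Gram inequality: [(s t)^2 - (p q - r)^2] is the
   Gram determinant, with [p], [q], [r] the products of [A B], [A C], [B C]. *)
rewrite ler_pdivlMr // mul1r -(ler_pXn2r (n := 2)) ?nnegrE ?(ltW st_gt0) //.
  by rewrite exprMn ss tt; lra.
by rewrite subr_ge0 ltW.
Qed.

Lemma side_lengthC A B : side_length A B = side_length B A.
Proof. by rewrite /side_length mdotC. Qed.

Lemma spacelike_sideC A B : spacelike_side A B -> spacelike_side B A.
Proof.
move=> [AB ANB sp]; split; first by rewrite eq_sym.
  by rewrite eq_sym eqr_oppLR.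
by rewrite addvC.
Qed.

End DeSitterGeometry.

Theorem theorem5p2 (R : realType) (A B C : 'rV[R]_3)
    (hABC : spatiolateral A B C) (hnc : ~ contractible A B C) :
  let a := side_length B C in
  let b := side_length A C in
  let c := side_length A B in
  let alpha := angle A B C in
  let beta := angle B A C in
  let gamma := angle C A B in
  [/\ cos a = cos b * cos c - cosh alpha * sin b * sin c,
      cos b = cos a * cos c - cosh beta * sin a * sin c &
      cos c = cos a * cos b - cosh gamma * sin a * sin b].
Proof.
move=> a b c alpha beta gamma.
case: hABC => -[AA BB CC] [_ [sAB sAC sBC]].
have span := noncontractible_positively_spans_axis hnc.
rewrite /a /b /c; split.
- exact: noncontractible_cosine_law.
- rewrite (side_lengthC A B); apply: noncontractible_cosine_law => //.
    exact: spacelike_sideC.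
  exact: positively_spans_axisC12.
- rewrite (side_lengthC A C) (side_lengthC B C).
  apply: noncontractible_cosine_law => //; try exact: spacelike_sideC.
  exact: positively_spans_axis_rot.
Qed.
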